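(* Let $\mathcal{S}$ be a b0-space such that $\Lambda^{\mathfrak f}\mathcal{C}(\mathcal{S})=\mathcal{C}(\mathcal{S})$ and let $\mathcal{T}$ be an arbitrary b0-space. Let $f\colon\mathcal{S}\to\mathcal{T}$ be a basic continuous map with basic preimage $f_{\leftarrow}$. Then $f$ is a basic closed map if and only if the map $f_{\leftarrow}^{\,\mathfrak{f}\mathfrak{c}}\colon\mathcal{C}^{\mathfrak f}(\mathcal{T})\to\mathcal{C}^{\mathfrak f}(\mathcal{S})$, $V\mapsto f_{\leftarrow}[V]$, has a left adjoint $h\colon\mathcal{C}^{\mathfrak f}(\mathcal{S})\to\mathcal{C}^{\mathfrak f}(\mathcal{T})$ with the following properties: (1) For every $C\in\mathcal{C}(\mathcal{S})$, $h[C]\in\mathcal{C}(\mathcal{T})$. (2) For every $C\in\mathcal{C}(\mathcal{S})$ and all $D_1,\dots,D_n\in\mathcal{C}(\mathcal{T})$, $h[C\cap f_{\leftarrow}^{\,\mathfrak{f}\mathfrak{c}}[D_1\cap\dots\cap D_n]]=h[C]\cap D_1\cap\dots\cap D_n$.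
   Context: A closure system on a set $X$ is a family of subsets of $X$ containing $X$ and closed under arbitrary intersections; ordered by inclusion it is a complete lattice whose meets are intersections and whose joins $\vee$ are the least members containing the union. A basic zero-dimensional space (b0-space) is a triple $\mathcal{S}=(X,\mathcal{C},\mathcal{B}d)$ where $X$ is a set, $\mathcal{B}d$ is a closure system on $X$ that is distributive as a lattice, and $\mathcal{C}\subseteq\mathcal{B}d$ is such that every $C\in\mathcal{C}$ has a complement $\neg C$ in the lattice $\mathcal{B}d$, and every $M\in\mathcal{B}d$ is of the form $M=\bigcap_{i\in J}(C_i^1\vee\neg D_i^1\vee\dots\vee C_i^{n_i}\vee\neg D_i^{n_i})$ with all $C_i^k,D_i^k\in\mathcal{C}$ (finite joins in $\mathcal{B}d$, the empty join being allowed). Write $|\mathcal{S}|=X$, $\mathcal{C}(\mathcal{S})=\mathcal{C}$ (the closed domains), $\mathcal{B}d(\mathcal{S})=\mathcal{B}d$; the bottom element of $\mathcal{B}d$ is denoted $\mathsf{O}$ (same symbol for every b0-space). A basic continuous map $f\colon\mathcal{S}\to\mathcal{T}$ between b0-spaces is a map $f\colon|\mathcal{S}|\to|\mathcal{T}|$ such that: (BC1) $f^{-1}[\mathsf{O}]=\mathsf{O}$; (BC2) there is a map $f_{\leftarrow}^{\mathfrak{c}}\colon\mathcal{C}(\mathcal{T})\to\mathcal{C}(\mathcal{S})$ such that $f[B]\subseteq C$ iff $B\subseteq f_{\leftarrow}^{\mathfrak{c}}[C]$ for all $B\in\mathcal{C}(\mathcal{S})$, $C\in\mathcal{C}(\mathcal{T})$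 (this map is then unique); (BC3) $\neg f_{\leftarrow}^{\mathfrak{c}}[C]\subseteq f^{-1}[\neg C]$ for all $C\in\mathcal{C}(\mathcal{T})$; (BC4) $\bigvee_{i=1}^n(f_{\leftarrow}^{\mathfrak{c}}[C_i]\vee\neg f_{\leftarrow}^{\mathfrak{c}}[D_i])\subseteq f^{-1}[\bigvee_{i=1}^n(C_i\vee\neg D_i)]$ for all $n$ and all $C_i,D_i\in\mathcal{C}(\mathcal{T})$. For a basic continuous $f$, the basic image is $f_{\rightarrow}\colon\mathcal{B}d(\mathcal{S})\to\mathcal{B}d(\mathcal{T})$, $f_{\rightarrow}[M]=\bigcap\{S\in\mathcal{B}d(\mathcal{T})\mid f[M]\subseteq S\}$; it has a right adjoint $f_{\leftarrow}\colon\mathcal{B}d(\mathcal{T})\to\mathcal{B}d(\mathcal{S})$ (so $f_{\rightarrow}[M]\subseteq K$ iff $M\subseteq f_{\leftarrow}[K]$), called the basic preimage of $f$. A basic continuous map $f$ is basic closed if $f_{\rightarrow}[B]\in\mathcal{C}(\mathcal{T})$ for every $B\in\mathcal{C}(\mathcal{S})$. For $\mathcal{X}\subseteq\mathcal{B}d(\mathcal{S})$, $\Lambda^{\mathfrak f}\mathcal{X}$ denotes the set of all finite meets (intersections), including the empty one $|\mathcal{S}|$, of elements of $\mathcal{X}$. The set $\mathcal{C}^{\mathfrak f}(\mathcal{S})$ of finitely generated closed domains consists of all finite joins in $\mathcal{B}d(\mathcal{S})$ (including the empty join $\mathsf{O}$) of elements of $\Lambda^{\mathfrak f}\mathcal{C}(\mathcal{S})$;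 it is ordered by inclusion. Since $f_{\leftarrow}$ sends closed domains to closed domains and preserves finite joins and finite meets, $f_{\leftarrow}^{\,\mathfrak{f}\mathfrak{c}}$ is well defined. *)

(* Defs.v *)
From mathcomp Require Import all_boot.
From mathcomp Require Import boolp classical_sets functions.

Set Implicit Arguments.
Unset Strict Implicit.
Unset Printing Implicit Defensive.

Local Open Scope classical_set_scope.

(* For a closure system Bd, [smallest Bd A] is the least member of Bd that
   contains A. *)
Definition closure_system (X : Type) (Bd : set (set X)) : Prop :=
  Bd setT /\
  (forall F : set (set X), F `<=` Bd -> Bd (\bigcap_(A in F) A)).

Definition bot (X : Type) (Bd : set (set X)) : set X := smallest Bd set0.

Definition join (X : Type) (Bd : set (set X)) (A B : set X) : set X :=
  smallest Bd (A `|` B).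

Definition distributive_lattice (X : Type) (Bd : set (set X)) : Prop :=
  forall A B C, Bd A -> Bd B -> Bd C ->
    A `&` join Bd B C = join Bd (A `&` B) (A `&` C).

Definition complement (X : Type) (Bd : set (set X)) (A N : set X) : Prop :=
  [/\ Bd N, A `&` N = bot Bd & join Bd A N = setT].

(* Meaningful only when A has a complement, which is then unique by
   distributivity (see [complement_uniq]). *)
Definition neg (X : Type) (Bd : set (set X)) (A : set X) : set X :=
  get [set N | complement Bd A N].

(* (C_0 \/ ~D_0) \/ ... \/ (C_(n-1) \/ ~D_(n-1)) *)
Definition basic_join (X : Type) (Bd : set (set X)) (n : nat)
    (C D : 'I_n -> set X) : set X :=
  \big[join Bd/bot Bd]_(i < n) join Bd (C i) (neg Bd (D i)).

Record b0space := B0Space {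
  carrier :> Type;
  cdom : set (set carrier);
  bdom : set (set carrier);
  bdom_closure : closure_system bdom;
  bdom_distr : distributive_lattice bdom;
  cdom_bdom : cdom `<=` bdom;
  cdom_compl : forall C, cdom C -> exists N, complement bdom C N;
  bdom_gen : forall M, bdom M ->
    exists (J : Type) (n : J -> nat) (C D : forall j : J, 'I_(n j) -> set carrier),
      (forall j i, cdom (C j i) /\ cdom (D j i)) /\
      M = \bigcap_(j in [set: J]) basic_join bdom (C j) (D j)
}.

Arguments cdom : clear implicits.
Arguments bdom : clear implicits.

(* The map [g] plays the role of the preimage on closed domains; only its
   values on [cdom T] matter. *)
Definition basic_continuous (S T : b0space) (f : S -> T) : Prop :=
  f @^-1` bot (bdom T) = bot (bdom S) /\
  exists g : set T -> set S,
    [/\ set_fun (cdom T) (cdom S) g,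
        forall B C, cdom S B -> cdom T C -> (f @` B `<=` C <-> B `<=` g C),
        forall C, cdom T C -> neg (bdom S) (g C) `<=` f @^-1` neg (bdom T) C
      & forall (n : nat) (C D : 'I_n -> set T),
          (forall i, cdom T (C i) /\ cdom T (D i)) ->
          basic_join (bdom S) (fun i => g (C i)) (fun i => g (D i))
            `<=` f @^-1` basic_join (bdom T) C D].

Definition basic_image (S T : b0space) (f : S -> T) (M : set S) : set T :=
  smallest (bdom T) (f @` M).

Definition basic_closed (S T : b0space) (f : S -> T) : Prop :=
  forall B, cdom S B -> cdom T (basic_image f B).

(* [l] and [r], restricted to the families P and Q of sets ordered by
   inclusion, are maps P -> Q and Q -> P with l left adjoint to r. *)
Definition adjoint (X Y : Type) (P : set (set X)) (Q : set (set Y))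
    (l : set X -> set Y) (r : set Y -> set X) : Prop :=
  [/\ set_fun P Q l, set_fun Q P r
    & forall M K, P M -> Q K -> (l M `<=` K <-> M `<=` r K)].

(* Every basic continuous map has a basic preimage, unique on [bdom T]: see
   [basic_preimage_ex] and [basic_preimage_uniq]. *)
Definition basic_preimage (S T : b0space) (f : S -> T) (g : set T -> set S)
    : Prop :=
  adjoint (bdom S) (bdom T) (basic_image f) g.

Definition fmeets (X : Type) (F : set (set X)) : set (set X) :=
  [set M | exists (n : nat) (A : 'I_n -> set X),
     (forall i, F (A i)) /\ M = \big[setI/setT]_(i < n) A i].

Definition fg_cdom (S : b0space) : set (set S) :=
  [set M | exists (n : nat) (A : 'I_n -> set S),
     (forall i, fmeets (cdom S) (A i)) /\
     M = \big[join (bdom S)/bot (bdom S)]_(i < n) A i].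

Arguments fg_cdom : clear implicits.

Section Facts.
Variables (X : Type) (Bd : set (set X)).
Hypotheses (clBd : closure_system Bd) (dBd : distributive_lattice Bd).

Lemma smallest_closed A : Bd (smallest Bd A).
Proof. by apply: clBd.2 => M []. Qed.

Lemma bot_sub A : Bd A -> bot Bd `<=` A.
Proof. by move=> BA; apply: smallest_sub. Qed.

Lemma closedI A B : Bd A -> Bd B -> Bd (A `&` B).
Proof.
move=> BA BB; have -> : A `&` B = \bigcap_(C in [set A; B]) C.
  by rewrite bigcap_setU !bigcap_set1.
by apply: clBd.2 => _ [] ->.
Qed.

Lemma joinl A B : A `<=` join Bd A B.
Proof. by move=> x Ax; apply: sub_gen_smallest; left. Qed.

Lemma joinr A B : B `<=` join Bd A B.
Proof. by move=> x Ax; apply: sub_gen_smallest; right. Qed.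

Lemma join_sub A B C : Bd C -> A `<=` C -> B `<=` C -> join Bd A B `<=` C.
Proof.
by move=> BC sAC sBC; apply: smallest_sub => // x []; [exact: sAC|exact: sBC].
Qed.

Lemma setI_join_sub A B C D : Bd A -> Bd B -> Bd C -> Bd D ->
  A `&` B `<=` D -> A `&` C `<=` D -> A `&` join Bd B C `<=` D.
Proof. by move=> BA BB BC BD sAB sAC; rewrite dBd//; apply: join_sub. Qed.

Lemma complement_sub A N M B : complement Bd A N -> Bd A -> Bd M -> Bd B ->
  M `&` N `<=` B -> M `<=` join Bd A B.
Proof.
move=> [BN _ AN] BA BM BB MN x Mx.
apply: (@setI_join_sub M A N) => //; first exact: smallest_closed.
- by move=> y [_ Ay]; exact: joinl.
- by move=> y /MN By; exact: joinr.
- by rewrite AN.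
Qed.

Lemma complement_sym A N : Bd A -> complement Bd A N -> complement Bd N A.
Proof. by move=> BA [BN AN0 AN1]; split; rewrite // 1?setIC // /join setUC. Qed.

Lemma complement_uniq A N N' : Bd A ->
  complement Bd A N -> complement Bd A N' -> N = N'.
Proof.
move=> BA; wlog suff H : N N' / complement Bd A N -> complement Bd A N' ->
    N `<=` N'.
  by move=> cN cN'; apply/seteqP; split; apply: H.
move=> cN cN' x Nx; have [BN AN _] := cN; have [BN' _ AN'] := cN'.
apply: (@setI_join_sub N A N' N') => //.
- by rewrite setIC AN; apply: bot_sub.
- by rewrite AN'.
Qed.

Lemma neg_complement A : (exists N, complement Bd A N) -> complement Bd A (neg Bd A).
Proof. exact: getPex. Qed.

Lemma bigjoin_closed I (r : seq I) (F : I -> set X) :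
  Bd (\big[join Bd/bot Bd]_(i <- r) F i).
Proof.
by case: r => [|i r]; rewrite ?big_nil ?big_cons; exact: smallest_closed.
Qed.

Lemma bigI_closed I (r : seq I) (F : I -> set X) : (forall i, Bd (F i)) ->
  Bd (\big[setI/setT]_(i <- r) F i).
Proof.
by move=> BF; elim/big_ind: _ => //; [exact: clBd.1|exact: closedI].
Qed.

Lemma bigjoin_disjoint I (r : seq I) (F G : I -> set X) :
  (forall i, Bd (F i)) -> (forall i, Bd (G i)) ->
  (forall i, G i `&` F i `<=` bot Bd) ->
  \big[setI/setT]_(i <- r) G i `&` \big[join Bd/bot Bd]_(i <- r) F i
    `<=` bot Bd.
Proof.
move=> BF BG GF; elim: r => [|i r IH]; first by rewrite !big_nil setTI.
have BGr := bigI_closed r BG.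
rewrite !big_cons; apply: setI_join_sub => //.
- exact: closedI.
- exact: bigjoin_closed.
- exact: smallest_closed.
- by move=> x [[Gx _] Fx]; apply: (GF i).
- by move=> x [[_ Gx] Fx]; apply: IH.
Qed.

Lemma sub_bigjoin I (r : seq I) (F G : I -> set X) M : Bd M ->
  (forall i, Bd (F i)) -> (forall i, complement Bd (F i) (G i)) ->
  M `&` \big[setI/setT]_(i <- r) G i `<=` bot Bd ->
  M `<=` \big[join Bd/bot Bd]_(i <- r) F i.
Proof.
move=> BM BF cFG; elim: r M BM => [|i r IH] M BM.
  by rewrite !big_nil setIT.
rewrite !big_cons setIA => MG; have [BGi _ _] := cFG i.
apply: (complement_sub (cFG i)) => //; first exact: bigjoin_closed.
by apply: IH => //; exact: closedI.
Qed.

Lemma complement_join_neg A B : Bd A -> Bd B ->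
  (exists N, complement Bd A N) -> (exists N, complement Bd B N) ->
  complement Bd (join Bd A (neg Bd B)) (neg Bd A `&` B).
Proof.
move=> BA BB /neg_complement cA /neg_complement cB.
have [BnA A0 A1] := cA; have [BnB B0 B1] := cB; split; first exact: closedI.
- apply/seteqP; split; last first.
    by apply: bot_sub; apply: closedI; [exact: smallest_closed|exact: closedI].
  rewrite setIC; apply: setI_join_sub => //.
  + exact: closedI.
  + exact: smallest_closed.
  + by move=> x [[nAx _] Ax]; rewrite -A0.
  + by move=> x [[_ Bx] nBx]; rewrite -B0.
- set V := join _ _ _.
  have BV : Bd V by exact: smallest_closed.
  have UV : join Bd A (neg Bd B) `<=` V by exact: joinl.
  have AV : A `<=` V by apply: subset_trans UV; exact: joinl.
  have nBV : neg Bd B `<=` V by apply: subset_trans UV; exact: joinr.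
  apply/seteqP; split=> //; rewrite -A1; apply: join_sub => //.
  apply: (@subset_trans _ (join Bd (neg Bd B) (neg Bd A `&` B))); last first.
    by apply: join_sub => //; exact: joinr.
  apply: (@complement_sub _ B) => //; last exact: closedI.
  exact: complement_sym.
Qed.

End Facts.

Section BasicPreimage.
Variables (S T : b0space) (f : S -> T).

Lemma basic_preimage_uniq g g' : basic_preimage f g -> basic_preimage f g' ->
  forall K, bdom T K -> g K = g' K.
Proof.
wlog suff H : g g' / basic_preimage f g -> basic_preimage f g' ->
    forall K, bdom T K -> g K `<=` g' K.
  by move=> Pg Pg' K BK; apply/seteqP; split; apply: H.
move=> [_ Bg gP] [_ _ gP'] K BK; have BgK := Bg _ BK.
by apply/(gP' _ _ BgK BK)/(gP _ _ BgK BK).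
Qed.

Lemma basic_preimage_ex : basic_continuous f -> exists g, basic_preimage f g.
Proof.
move=> [f0 [c [Bc cP cN cJ]]].
have clS := @bdom_closure S; have dS := @bdom_distr S.
have clT := @bdom_closure T; have dT := @bdom_distr T.
pose g K := smallest (bdom S)
  (\bigcup_(M in [set M | bdom S M /\ f @` M `<=` K]) M).
exists g; split.
- by move=> M _; exact: smallest_closed.
- by move=> K _; exact: smallest_closed.
move=> M K BM BK; split=> [MK|MK].
  apply: subset_trans (@sub_gen_smallest _ _ _) => x Mx; exists M => //.
  by split=> //; apply: subset_trans MK; exact: sub_gen_smallest.
apply: smallest_sub => // _ [x /MK gx <-].
have [J [n [C [D [CD KE]]]]] := bdom_gen BK.
rewrite KE => j _; apply: (cJ _ _ _ (CD j)).
have cC i : cdom S (c (C j i)) by apply: Bc; exact: (CD j i).1.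
have cD i : cdom S (c (D j i)) by apply: Bc; exact: (CD j i).2.
have BC i : bdom T (C j i) by apply: cdom_bdom; exact: (CD j i).1.
have BD i : bdom T (D j i) by apply: cdom_bdom; exact: (CD j i).2.
have eC i := cdom_compl (CD j i).1; have eD i := cdom_compl (CD j i).2.
move: x gx; apply: smallest_sub; first exact: bigjoin_closed.
move=> x [N [BN NK] Nx]; move: x Nx.
apply: (@sub_bigjoin _ _ clS dS _ _ _
  (fun i => neg (bdom S) (c (C j i)) `&` c (D j i))) => //.
- by move=> i; exact: smallest_closed.
- by move=> i; apply: complement_join_neg; rewrite //; solve
    [exact: cdom_bdom | exact: cdom_compl].
move=> x [Nx]; rewrite -bigcap_seq => Gx.
rewrite -f0 /=.
apply: (@bigjoin_disjoint _ _ clT dT _ (index_enum 'I_(n j))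
  (fun i => join (bdom T) (C j i) (neg (bdom T) (D j i)))
  (fun i => neg (bdom T) (C j i) `&` D j i)).
- by move=> i; exact: smallest_closed.
- by move=> i; apply: closedI => //; have [] := neg_complement (eC i).
- move=> i; have [_ <- _] := complement_join_neg clT dT (BC i) (BD i) (eC i) (eD i).
  by rewrite setIC.
split; last first.
  have : K (f x) by apply: NK; exists x.
  by rewrite KE; apply.
rewrite -bigcap_seq => i /Gx [nC Di]; split.
  by apply: cN nC; exact: (CD j i).1.
have [_] := cP _ _ (cD i) (CD j i).2.
by apply=> //; exists x.
Qed.

End BasicPreimage.

(* Main.v *)
Require Import Defs.
From mathcomp Require Import all_boot.
From mathcomp Require Import boolp classical_sets functions.

(** If [f] is basic closed, the left adjoint is the basic image itself. It
    preserves joins because it is a left adjoint of [preim], and under the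
    hypothesis on [S] every finitely generated closed domain of [S] is a finite
    join of closed domains, so the image is finitely generated.  Property (2)
    is Frobenius reciprocity: with [K] the image of [C `&` preim D], moving [D]
    to the right as its complement turns [image C `&` D `<=` K] into
    [C `<=` preim (join K (neg D))], which is [C `&` preim D `<=` preim K] as
    soon as [preim] respects the complement of [D] ([image_frobenius]).

    Conversely, suppose [h] is given; then [h B] is the basic image of [B] for
    each closed domain [B].  One inclusion is the unit of the adjunction.  For
    the other, the basic image is an intersection of basic joins, so it is
    enough that [h B] lies in each basic join of [C i] and [neg (D i)] that
    contains [f @` B].  Shifting the complements to the left
    ([sub_basic_joinP]) reduces this to [h B] met with the [D i] being below
    the join of the [C i]; by (2) this meet is [h] of a closed domain, and the
    adjunction applies because the join of the [C i] is finitely generated.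

    Both directions rest on the behaviour of [preim] on complemented members.
    Condition (BC3) makes it send a closed domain to a closed domain and the
    complement to the complement ([preim_cdom], [keeps_complement_cdom]).  The
    members whose complement is kept in this way are closed under finite meets
    and joins, and [preim] preserves finite joins of them
    ([preim_join]). *)

Set Implicit Arguments.
Unset Strict Implicit.

Local Open Scope classical_set_scope.

(** * Complements in a distributive closure system *)

Section Lattice.
Variables (X : Type) (Bd : set (set X)).
Hypotheses (clBd : closure_system Bd) (dBd : distributive_lattice Bd).

(** One of De Morgan's laws; the dual one is obtained by exchanging the roles
    of the members and their complements. *)
Lemma complement_join A B N M : Bd A -> Bd B ->
  complement Bd A N -> complement Bd B M ->
  complement Bd (join Bd A B) (N `&` M).
Proof.
move=> BA BB cA cB; have [BN AN _] := cA; have [BM BM0 _] := cB.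
have BNM : Bd (N `&` M) by exact: closedI.
have BJ : Bd (join Bd A B) by exact: smallest_closed.
split=> //; apply/seteqP; split=> //.
- rewrite setIC; apply: setI_join_sub => //; first exact: smallest_closed.
  + by move=> x [[Nx _] Ax]; rewrite -AN.
  + by move=> x [[_ Mx] Bx]; rewrite -BM0.
- by apply: bot_sub; exact: closedI.
- have BV : Bd (join Bd (join Bd A B) (N `&` M)) by exact: smallest_closed.
  have [VA VB] : A `<=` join Bd (join Bd A B) (N `&` M) /\
      B `<=` join Bd (join Bd A B) (N `&` M).
    by split; apply: subset_trans (@joinl _ _ _ _);
      [exact: joinl | exact: joinr].
  have [_ _ <-] := cA; apply: join_sub => // x Nx.
  apply: (@join_sub _ Bd B (N `&` M)) => //; first exact: joinr.
  by apply: (complement_sub clBd dBd cB) x Nx.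
Qed.

End Lattice.

(** * Closed domains and basic joins *)

Lemma fmeets_incl (X : Type) (F : set (set X)) : F `<=` fmeets F.
Proof.
by move=> A FA; exists 1, (fun=> A); rewrite big_ord_recl big_ord0 setIT.
Qed.

Lemma fmeetsI (X : Type) (F : set (set X)) (A B : set X) :
  F A -> F B -> fmeets F (A `&` B).
Proof.
move=> FA FB; exists 2, (fun i : 'I_2 => if i == ord0 then A else B).
split; first by move=> i; case: ifP.
by rewrite !big_ord_recl big_ord0 setIT.
Qed.

Section B0Space.
Variable S : b0space.

Lemma fg_cdom_bigjoin n (A : 'I_n -> set S) : (forall i, cdom S (A i)) ->
  fg_cdom S (\big[join (bdom S)/bot (bdom S)]_(i < n) A i).
Proof. by move=> cA; exists n, A; split=> // i; exact: fmeets_incl. Qed.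

Lemma join_bot A : bdom S A -> join (bdom S) A (bot (bdom S)) = A.
Proof.
move=> BA; apply/seteqP; split; last exact: joinl.
by apply: join_sub => //; exact: bot_sub.
Qed.

Lemma cdom_fg_cdom : cdom S `<=` fg_cdom S.
Proof.
move=> A cA; exists 1, (fun=> A); split; first by move=> _; exact: fmeets_incl.
by rewrite big_ord_recl big_ord0 join_bot//; exact: cdom_bdom.
Qed.

Lemma cdom_neg C : cdom S C -> complement (bdom S) C (neg (bdom S) C).
Proof. by move=> cC; apply: neg_complement; exact: cdom_compl. Qed.

(** A basic join is a finite implication: the domains occurring negatively can
    be moved to the left of the inclusion. *)
Lemma sub_basic_joinP n (C D : 'I_n -> set S) M : bdom S M ->
  (forall i, cdom S (C i) /\ cdom S (D i)) ->
  M `<=` basic_join (bdom S) C D <->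
  M `&` \big[setI/setT]_(i < n) D i
    `<=` \big[join (bdom S)/bot (bdom S)]_(i < n) C i.
Proof.
move=> BM CD; have cl := @bdom_closure S; have ds := @bdom_distr S.
have BC i : bdom S (C i) by apply: cdom_bdom; exact: (CD i).1.
have BD i : bdom S (D i) by apply: cdom_bdom; exact: (CD i).2.
have cC i := cdom_neg (CD i).1.
have cCD i : complement (bdom S) (join (bdom S) (C i) (neg (bdom S) (D i)))
    (neg (bdom S) (C i) `&` D i).
  by apply: complement_join_neg => //; apply: cdom_compl;
    [exact: (CD i).1|exact: (CD i).2].
have BnC i : bdom S (neg (bdom S) (C i)) by have [] := cC i.
have BnCD i : bdom S (neg (bdom S) (C i) `&` D i) by exact: closedI.
have BJ i : bdom S (join (bdom S) (C i) (neg (bdom S) (D i))).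
  exact: smallest_closed.
have BMD : bdom S (M `&` \big[setI/setT]_(i < n) D i).
  by apply: closedI => //; exact: bigI_closed.
split=> H.
- apply: (sub_bigjoin cl ds BMD BC cC) => x [[/H Jx]].
  rewrite -!bigcap_seq => Dx nCx.
  apply: (bigjoin_disjoint cl ds BJ BnCD) => [i|].
    by have [_ <- _] := cCD i; rewrite setIC.
  by split; last exact: Jx; rewrite -bigcap_seq => i ri; split; [exact: nCx|exact: Dx].
- apply: (sub_bigjoin cl ds BM BJ cCD) => x [Mx].
  rewrite -bigcap_seq => nCDx.
  apply: (bigjoin_disjoint cl ds BC BnC) => [i|].
    by have [_ <- _] := cC i; rewrite setIC.
  split; first by rewrite -bigcap_seq => i /nCDx [].
  by apply: H; split=> //; rewrite -bigcap_seq => i /nCDx [].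
Qed.

End B0Space.

(** * The basic preimage on complemented members *)

Section Preimage.
Variables (S T : b0space) (f : S -> T) (preim : set T -> set S).
Hypotheses (fBC : basic_continuous f) (fP : basic_preimage f preim).

Let clS := @bdom_closure S.
Let dS := @bdom_distr S.
Let clT := @bdom_closure T.
Let dT := @bdom_distr T.

Lemma basic_image_sub M K : bdom T K ->
  basic_image f M `<=` K <-> f @` M `<=` K.
Proof.
move=> BK; split=> [|MK]; last exact: smallest_sub.
by apply: subset_trans; exact: sub_gen_smallest.
Qed.

Lemma basic_image_bdom M : bdom T (basic_image f M).
Proof. exact: smallest_closed. Qed.

Lemma preim_bdom K : bdom T K -> bdom S (preim K).
Proof. by case: fP => _ + _; apply. Qed.

Lemma sub_preim M K : bdom S M -> bdom T K ->
  basic_image f M `<=` K <-> M `<=` preim K.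
Proof. by case: fP => _ _; apply. Qed.

Lemma image_sub_preim M K : bdom S M -> bdom T K ->
  f @` M `<=` K <-> M `<=` preim K.
Proof. by move=> BM BK; rewrite -sub_preim// basic_image_sub. Qed.

Lemma preim_sub_preimage K : bdom T K -> preim K `<=` f @^-1` K.
Proof.
move=> BK x Kx; have BpK := preim_bdom BK.
by have [_] := image_sub_preim BpK BK; apply=> //; exists x.
Qed.

Lemma preim_mono K L : bdom T K -> bdom T L -> K `<=` L ->
  preim K `<=` preim L.
Proof.
move=> BK BL KL; have BpK := preim_bdom BK.
by apply/(image_sub_preim BpK BL) => _ [x /(preim_sub_preimage BK) /KL ? <-].
Qed.

Lemma preimT : preim setT = setT.
Proof.
by apply/seteqP; split=> //; apply/image_sub_preim => //;
  [exact: clS.1|exact: clT.1].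
Qed.

Lemma preimI K L : bdom T K -> bdom T L ->
  preim (K `&` L) = preim K `&` preim L.
Proof.
move=> BK BL; have BKL := closedI clT BK BL.
apply/seteqP; split.
  by rewrite subsetI; split; apply: preim_mono => // x [].
apply/image_sub_preim => //; first by apply: closedI => //; exact: preim_bdom.
by move=> _ [x [Kx Lx] <-]; split; exact: preim_sub_preimage.
Qed.

Lemma preim_bigI n (D : 'I_n -> set T) : (forall i, bdom T (D i)) ->
  preim (\big[setI/setT]_(i < n) D i) = \big[setI/setT]_(i < n) preim (D i).
Proof.
elim: n D => [|n IH] D BD; first by rewrite !big_ord0 preimT.
by rewrite !big_ord_recl preimI ?IH//; exact: bigI_closed.
Qed.

Lemma preim_bot : preim (bot (bdom T)) = bot (bdom S).
Proof.
have BT : bdom T (bot (bdom T)) by exact: smallest_closed.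
apply/seteqP; split; last by apply: bot_sub; exact: preim_bdom.
by have [<- _] := fBC; exact: preim_sub_preimage.
Qed.

(** For [c] the map on closed domains given by (BC2), [c C `<=` preim C] is
    immediate and (BC3) gives [neg (c C) `<=` preim (neg C)].  Since [preim C]
    and [preim (neg C)] are disjoint by (BC1), neither inclusion can be strict:
    the smaller sets are already complementary. *)
Lemma preim_cdom_neg C : cdom T C ->
  cdom S (preim C) /\
  preim (neg (bdom T) C) = neg (bdom S) (preim C).
Proof.
move=> cC; have BC := cdom_bdom cC; have [BN CN _] := cdom_neg cC.
have BpC := preim_bdom BC; have BpN := preim_bdom BN.
have [_ [c [cc cP c3 _]]] := fBC.
have ccC := cc _ cC; have BcC := cdom_bdom ccC.
have [Bnc _ _] := cdom_neg ccC.
have ncN : neg (bdom S) (c C) `<=` preim (neg (bdom T) C).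
  by apply/image_sub_preim => // _ [x Nx <-]; exact: (c3 _ cC).
have disj : preim C `&` preim (neg (bdom T) C) `<=` bot (bdom S).
  by rewrite -preimI// CN preim_bot.
have cCE : preim C = c C.
  apply/seteqP; split; last by apply/image_sub_preim => //; apply/cP.
  rewrite -(join_bot BcC).
  apply: (complement_sub clS dS (cdom_neg ccC)) => //.
    exact: smallest_closed.
  by move=> x [Cx /ncN Nx]; exact: disj.
rewrite -cCE in ccC ncN *; split=> //.
apply/seteqP; split=> // x Nx.
have [Bn _ _] := cdom_neg ccC.
rewrite -(join_bot Bn).
apply: (complement_sub clS dS (complement_sym BpC (cdom_neg ccC))) Nx => //.
  exact: smallest_closed.
by rewrite setIC.
Qed.

Lemma preim_cdom C : cdom T C -> cdom S (preim C).
Proof. by case/preim_cdom_neg. Qed.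

(** A relation rather than a predicate on [A], so that it is symmetric: the
    statements about meets then follow from those about joins. *)
Definition keeps_complement A N :=
  [/\ bdom T A, complement (bdom T) A N
    & complement (bdom S) (preim A) (preim N)].

Lemma keeps_complement_cdom C : cdom T C ->
  keeps_complement C (neg (bdom T) C).
Proof.
move=> cC; have [cpC pN] := preim_cdom_neg cC.
by split; [exact: cdom_bdom|exact: cdom_neg|rewrite pN; exact: cdom_neg].
Qed.

Lemma keeps_complement_sym A N :
  keeps_complement A N -> keeps_complement N A.
Proof.
move=> [BA cA cpA]; split; first by have [] := cA.
- exact: complement_sym.
- by apply: complement_sym => //; exact: preim_bdom.
Qed.

Lemma keeps_complement_bot : keeps_complement (bot (bdom T)) setT.
Proof.
have botT (R : b0space) : complement (bdom R) (bot (bdom R)) setT.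
  split; [exact: (@bdom_closure R).1|by rewrite setIT|].
  by apply/seteqP; split=> //; exact: joinr.
by split; rewrite ?preim_bot ?preimT//; exact: smallest_closed.
Qed.

(** A right adjoint preserves meets for free; a join is preserved because its
    complement is a meet of complements, and [preim] keeps all of these. *)
Lemma preim_join A B N M : keeps_complement A N -> keeps_complement B M ->
  preim (join (bdom T) A B) = join (bdom S) (preim A) (preim B).
Proof.
move=> [BA cA cpA] [BB cB cpB].
have BpA := preim_bdom BA; have BpB := preim_bdom BB.
have BJ : bdom T (join (bdom T) A B) by exact: smallest_closed.
have BpJ := preim_bdom BJ.
have BJp : bdom S (join (bdom S) (preim A) (preim B)) by exact: smallest_closed.
apply/seteqP; split; last first.
  by apply: join_sub => //; apply: preim_mono => //; [exact: joinl|exact: joinr].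
have [[BN _ _] [BM _ _]] := (cA, cB).
have [BNM JNM _] := complement_join clT dT BA BB cA cB.
rewrite -(join_bot BJp).
apply: (complement_sub clS dS (complement_join clS dS BpA BpB cpA cpB)) => //.
  exact: smallest_closed.
by rewrite -preimI// -preimI// JNM preim_bot.
Qed.

Lemma keeps_complement_join A B N M :
  keeps_complement A N -> keeps_complement B M ->
  keeps_complement (join (bdom T) A B) (N `&` M).
Proof.
move=> kA kB; have [[BA cA cpA] [BB cB cpB]] := (kA, kB).
have [[BN _ _] [BM _ _]] := (cA, cB); split; first exact: smallest_closed.
- exact: complement_join.
- rewrite (preim_join kA kB) preimI//.
  by apply: complement_join => //; exact: preim_bdom.
Qed.

Lemma keeps_complement_meet A B N M :
  keeps_complement A N -> keeps_complement B M ->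
  keeps_complement (A `&` B) (join (bdom T) N M).
Proof.
move=> /keeps_complement_sym kN /keeps_complement_sym kM.
exact/keeps_complement_sym/keeps_complement_join.
Qed.

Lemma keeps_complement_bigI n (D : 'I_n -> set T) :
  (forall i, exists N, keeps_complement (D i) N) ->
  exists N, keeps_complement (\big[setI/setT]_(i < n) D i) N.
Proof.
move=> kD; elim/big_ind: _ => [|A B [N kA] [M kB]|i _]; last exact: kD.
- exists (bot (bdom T)); exact/keeps_complement_sym/keeps_complement_bot.
- by exists (join (bdom T) N M); exact: keeps_complement_meet.
Qed.

Lemma preim_bigjoin n (A : 'I_n -> set T) :
  (forall i, exists N, keeps_complement (A i) N) ->
  (exists N, keeps_complement (\big[join (bdom T)/bot (bdom T)]_(i < n) A i) N)
  /\ preim (\big[join (bdom T)/bot (bdom T)]_(i < n) A i) =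
     \big[join (bdom S)/bot (bdom S)]_(i < n) preim (A i).
Proof.
elim: n A => [|n IH] A kA.
  rewrite !big_ord0 preim_bot; split=> //.
  by exists setT; exact: keeps_complement_bot.
rewrite !big_ord_recl; have [N kA0] := kA ord0.
have [[M kJ] <-] := IH _ (fun i => kA (lift ord0 i)).
split; last exact: preim_join kA0 kJ.
by exists (N `&` M); exact: keeps_complement_join.
Qed.

Lemma preim_fg_cdom V : fg_cdom T V -> fg_cdom S (preim V).
Proof.
move=> [n [A [mA ->]]].
have kA i : exists N, keeps_complement (A i) N.
  have [m [D [cD ->]]] := mA i; apply: keeps_complement_bigI => j.
  by exists (neg (bdom T) (D j)); exact: keeps_complement_cdom.
have [_ ->] := preim_bigjoin kA; exists n, (fun i => preim (A i)); split=> // i.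
have [m [D [cD ->]]] := mA i; rewrite preim_bigI => [|j]; last exact: cdom_bdom.
by exists m, (fun j => preim (D j)); split=> // j; exact: preim_cdom.
Qed.

(** * The basic image *)

Lemma basic_image_mono M M' : M `<=` M' -> basic_image f M `<=` basic_image f M'.
Proof.
move=> MM'; apply/(basic_image_sub _ (basic_image_bdom M')).
by move=> _ [x /MM' M'x <-]; apply: sub_gen_smallest; exists x.
Qed.

(** The inclusion from left to right is formal.  For the other, meeting with [K]
    is left adjoint to joining with [N], and meeting with [preim K] is left
    adjoint to joining with [preim N]; transposing both sides leaves
    [join (preim N) (preim L) `<=` preim (join N L)], where [L] is the left-hand
    side, and this is monotonicity of [preim]. *)
Lemma image_frobenius M K N : bdom S M -> keeps_complement K N ->
  basic_image f (M `&` preim K) = basic_image f M `&` K.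
Proof.
move=> BM [BK cK cpK]; have BpK := preim_bdom BK.
have BMK : bdom S (M `&` preim K) by exact: closedI.
apply/seteqP; split.
  rewrite subsetI; split; first by apply: basic_image_mono => x [].
  by apply/sub_preim => // x [].
have [BN KN _] := cK; set L := basic_image f (M `&` preim K).
have BL : bdom T L by exact: basic_image_bdom.
have BNL : bdom T (join (bdom T) N L) by exact: smallest_closed.
have BpNL := preim_bdom BNL; have BpN := preim_bdom BN.
have BpL := preim_bdom BL.
have ML : basic_image f M `<=` join (bdom T) N L.
  apply/sub_preim => //.
  apply: (@subset_trans _ (join (bdom S) (preim N) (preim L))).
    apply: (complement_sub clS dS (complement_sym BpK cpK)) => //.
    exact/(sub_preim BMK BL).
  by apply: join_sub => //; apply: preim_mono => //; [exact: joinl|exact: joinr].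
move=> x [/ML NLx Kx].
apply: (@setI_join_sub _ (bdom T) dT K N L L) => //.
by rewrite KN; exact: bot_sub.
Qed.

Lemma basic_image_bigjoin n (A : 'I_n -> set S) : (forall i, bdom S (A i)) ->
  basic_image f (\big[join (bdom S)/bot (bdom S)]_(i < n) A i) =
  \big[join (bdom T)/bot (bdom T)]_(i < n) basic_image f (A i).
Proof.
move=> BA; apply/seteqP; split.
- have BJ : bdom T (\big[join (bdom T)/bot (bdom T)]_(i < n)
    basic_image f (A i)) by exact: bigjoin_closed.
  apply/sub_preim => //; first exact: bigjoin_closed.
  elim: n A BA BJ => [|n IH] A BA BJ; first by rewrite !big_ord0 preim_bot.
  rewrite !big_ord_recl in BJ *.
  have BJ' : bdom T (\big[join (bdom T)/bot (bdom T)]_(i < n)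
    basic_image f (A (lift ord0 i))) by exact: bigjoin_closed.
  apply: join_sub; first exact: preim_bdom.
    by apply/sub_preim => //; exact: joinl.
  apply: subset_trans (IH _ _ BJ') _ => //.
  by apply: preim_mono => //; exact: joinr.
- elim: n A BA => [|n IH] A BA.
    by rewrite !big_ord0; apply: bot_sub; exact: basic_image_bdom.
  rewrite !big_ord_recl; apply: join_sub; first exact: basic_image_bdom.
    by apply: basic_image_mono; exact: joinl.
  apply: subset_trans (IH _ _) _ => //.
  by apply: basic_image_mono; exact: joinr.
Qed.

(** * Closed maps and left adjoints of the preimage *)

Lemma basic_closed_adjoint : fmeets (cdom S) = cdom S -> basic_closed f ->
  adjoint (fg_cdom S) (fg_cdom T) (basic_image f) preim.
Proof.
move=> mS clf.
have Bfg (R : b0space) V : fg_cdom R V -> bdom R V.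
  by move=> [n [A [_ ->]]]; apply: bigjoin_closed; exact: bdom_closure.
split.
- move=> _ [n [A [mA ->]]]; rewrite mS in mA.
  rewrite basic_image_bigjoin => [|i]; last exact: cdom_bdom.
  by apply: fg_cdom_bigjoin => i; exact: clf.
- exact: preim_fg_cdom.
- by move=> M K /Bfg BM /Bfg BK; exact: sub_preim.
Qed.

(** The adjoint [h] is only tested against finitely generated closed domains,
    whereas the basic image is the least member of the whole system above
    [f @` B].  Property (2) bridges the gap: it lets [h] be tested against
    basic joins, and these determine all the members. *)
Lemma adjoint_basic_image (h : set S -> set T) : fmeets (cdom S) = cdom S ->
  adjoint (fg_cdom S) (fg_cdom T) h preim ->
  (forall C, cdom S C -> cdom T (h C)) ->
  (forall C n (D : 'I_n -> set T), cdom S C -> (forall i, cdom T (D i)) ->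
     h (C `&` preim (\big[setI/setT]_(i < n) D i)) =
     h C `&` \big[setI/setT]_(i < n) D i) ->
  forall B, cdom S B -> basic_image f B = h B.
Proof.
move=> mS [_ _ hP] hc hI B cB; have chB := hc _ cB.
have BB := cdom_bdom cB; have BhB := cdom_bdom chB.
have fgB := cdom_fg_cdom cB; have fghB := cdom_fg_cdom chB.
apply/seteqP; split; first by apply/sub_preim => //; exact/(hP _ _ fgB fghB).
have [J [n [C [D [CD imE]]]]] := bdom_gen (basic_image_bdom B).
rewrite imE => x hBx j _; move: x hBx.
(* shift the complements away, then absorb the meet into h by (2) *)
have cD i : cdom T (D j i) := (CD j i).2.
apply/sub_basic_joinP => //; rewrite -hI//.
have cBD : cdom S (B `&` preim (\big[setI/setT]_(i < n j) D j i)).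
  rewrite -mS; apply: fmeetsI => //.
  rewrite preim_bigI => [|i]; last exact: cdom_bdom.
  rewrite -mS; exists (n j), (fun i => preim (D j i)).
  by split=> // i; exact: preim_cdom.
have fgC := fg_cdom_bigjoin (fun i => (CD j i).1).
apply/(hP _ _ (cdom_fg_cdom cBD) fgC); apply/sub_preim.
- exact: cdom_bdom.
- exact: bigjoin_closed.
(* the same meet with the basic image is absorbed by reciprocity *)
have [N kD] : exists N, keeps_complement (\big[setI/setT]_(i < n j) D j i) N.
  apply: keeps_complement_bigI => i; exists (neg (bdom T) (D j i)).
  exact: keeps_complement_cdom.
rewrite (image_frobenius BB kD); apply/(sub_basic_joinP (basic_image_bdom B)) => //.
by rewrite {1}imE => y; apply.
Qed.

End Preimage.

Unset Implicit Arguments.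
Set Strict Implicit.

Theorem theorem10p3 (S T : b0space) (f : S -> T) (preim : set T -> set S) :
  fmeets (cdom S) = cdom S ->
  basic_continuous f ->
  basic_preimage f preim ->
  (basic_closed f <->
  exists h : set S -> set T,
    [/\ adjoint (fg_cdom S) (fg_cdom T) h preim,
        forall C : set S, cdom S C -> cdom T (h C)
      & forall (C : set S) (n : nat) (D : 'I_n -> set T),
          cdom S C -> (forall i, cdom T (D i)) ->
          h (C `&` preim (\big[setI/setT]_(i < n) D i))
            = h C `&` \big[setI/setT]_(i < n) D i]).
Proof.
move=> mS fBC fP; split=> [clf|[h [hP hc hI]] B cB].
- exists (basic_image f); split=> //; first exact: basic_closed_adjoint.
  move=> C n D cC cD.
  have [N kD] : exists N, keeps_complement preim (\big[setI/setT]_(i < n) D i) N.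
    apply: (keeps_complement_bigI fBC fP) => i; exists (neg (bdom T) (D i)).
    exact: (keeps_complement_cdom fBC fP).
  by apply: (image_frobenius fP _ kD); exact: cdom_bdom.
- by rewrite (adjoint_basic_image fBC fP mS hP hc hI cB); exact: hc.
Qed.
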